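(* Let $K=(K_{j,k})_{j,k\in\mathbb{N}_0}$ be an interaction kernel for which there are constants $C_q>0$ and $\mu,\nu\in[0,2]$ with $\mu+\nu\le 3$ such that $$0\le K_{j,k}=K_{k,j}\le C_q\,(j^{\mu}k^{\nu}+j^{\nu}k^{\mu})\qquad\text{for all } j,k\in\mathbb{N}_0 .$$ Let $f(0)\in Y_1^+$ with $\rho:=M_1(f(0))<\infty$, and assume that either (a) $\lambda:=\max\{\mu,\nu\}>1$ and $f(0)\in Y_\lambda^+$, or (b) $\max\{\mu,\nu\}\le1$. Let $f=(f_j)_{j\ge0}$ be the global mild solution of the EDG system with kernel $K$ and initial data $f(0)$ constructed as the limit of solutions of the truncated systems (see context), with $f(t)\in Y_\lambda^+$ for all $t\geq 0$ in case (a) and $f(t)\in Y_1^+$ for all $t\geq 0$ in case (b). Then $f$ is a continuously differentiable solution of the EDG system (each $f_j$ is continuously differentiable and the differential equations hold pointwise), and $$M_0(f(t))=M_0(f(0)),\qquad M_1(f(t))=\rho\qquad\text{for all } t\in[0,\infty).$$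
   Context: $\mathbb{N}=\{1,2,\dots\}$, $\mathbb{N}_0=\mathbb{N}\cup\{0\}$, and $0^0=1$. For $r\ge0$, $Y_r$ is the set of real sequences $f=(f_j)_{j\ge0}$ with $\|f\|_r:=\sum_{j\ge0} j^r|f_j|<\infty$, and $Y_r^+=\{f\in Y_r: f_j\ge0\ \forall j\}$. $M_p(f)=\sum_{j\ge0}j^pf_j$ for $p>0$ and $M_0(f)=\sum_{j\ge0}f_j$. The exchange-driven growth (EDG) system with kernel $K$ is $$\dot f_j=f_{j+1}\sum_{k=0}^\infty K_{j+1,k}f_k-f_j\sum_{k=0}^\infty K_{j,k}f_k-f_j\sum_{k=1}^\infty K_{k,j}f_k+f_{j-1}\sum_{k=1}^\infty K_{k,j-1}f_k\quad(j\in\mathbb{N}),$$ $$\dot f_0=f_1\sum_{k=0}^\infty K_{1,k}f_k-f_0\sum_{k=1}^\infty K_{k,0}f_k,$$ with prescribed initial data $f_j(0)$. Mild solution: a mild solution on $[0,T)$ is a function $f:[0,T)\to Y_r^+$ with initial value $f(0)$ such that (1) each $f_j:[0,T)\to[0,\infty)$ is continuous and $\sup_{t\in[0,T)}\|f(t)\|_r<\infty$; (2) $\int_0^t\sum_{k=0}^\infty K_{j,k}f_k(s)\,ds<\infty$ for all $j\in\mathbb{N}_0$, $t\in[0,T)$; (3) the EDG equations hold in time-integrated form for all $j\in\mathbb{N}_0$, $t\in[0,T)$. A global mild solution is a function on $[0,\infty)$ whose restriction to $[0,T)$ is a mild solution for every $T\in(0,\infty)$; here $r=\lambda$ in case (a)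 and $r=1$ in case (b). Truncated systems and the constructed solution: for $N\ge2$ let $(f_j^N)_{0\le j\le N}$ be the unique non-negative continuously differentiable solution on $[0,\infty)$ of $$\dot f_0^N=f_1^N\sum_{k=0}^{N-1}K_{1,k}f_k^N-f_0^N\sum_{k=1}^NK_{k,0}f_k^N,$$ $$\dot f_j^N=f_{j+1}^N\sum_{k=0}^{N-1}K_{j+1,k}f_k^N-f_j^N\sum_{k=0}^{N-1}K_{j,k}f_k^N-f_j^N\sum_{k=1}^NK_{k,j}f_k^N+f_{j-1}^N\sum_{k=1}^NK_{k,j-1}f_k^N\quad(1\le j\le N-1),$$ $$\dot f_N^N=-f_N^N\sum_{k=0}^{N-1}K_{N,k}f_k^N+f_{N-1}^N\sum_{k=1}^NK_{k,N-1}f_k^N,$$ with $f_j^N(0)=f_j(0)$ for $0\le j\le N$, and set $f_j^N:=0$ for $j>N$. The constructed solution $f$ is the limit of a subsequence of $(f^N)_{N\ge 2}$ such that, for every $j\in\mathbb{N}_0$, $f_j^N\to f_j$ along the subsequence uniformly on $[0,T]$ for every $T\in(0,\infty)$. *)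

(* Defs.v *)
From HB Require Import structures.
From mathcomp Require Import all_boot all_order all_algebra.
From mathcomp Require Import all_classical all_reals all_analysis.

Set Implicit Arguments.
Unset Strict Implicit.
Unset Printing Implicit Defensive.

Import Order.TTheory GRing.Theory Num.Theory.
Import numFieldNormedType.Exports.

Local Open Scope classical_set_scope.
Local Open Scope ring_scope.
Local Open Scope ereal_scope.

(* Powers use powR, for which 0 `^ 0 = 1 and 0 `^ r = 0 when r != 0. *)

Definition normY (R : realType) (r : R) (f : nat -> R) : \bar R :=
  \sum_(0 <= j <oo) (j%:R `^ r * `|f j|)%:E.

Definition inY (R : realType) (r : R) (f : nat -> R) : Prop :=
  normY r f < +oo.

Definition inYplus (R : realType) (r : R) (f : nat -> R) : Prop :=
  inY r f /\ forall j, (0 <= f j)%R.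

(* At p = 0 the factor is 1 for every j, including j = 0. *)
Definition moment (R : realType) (p : R) (f : nat -> R) : \bar R :=
  \sum_(0 <= j <oo) (j%:R `^ p * f j)%:E.

Definition kernel_bound (R : realType) (Cq mu nu : R) (K : nat -> nat -> R) :
    Prop :=
  forall j k : nat,
    (0 <= K j k)%R /\ K j k = K k j /\
    (K j k <= Cq * (j%:R `^ mu * k%:R `^ nu + j%:R `^ nu * k%:R `^ mu))%R.

(* The infinite sums, and hence the right-hand side, are taken in \bar R, since
   a mild solution only guarantees their finiteness for almost every time. *)
Definition EDG_rhs (R : realType) (K : nat -> nat -> R) (f : nat -> R)
    (j : nat) : \bar R :=
  match j with
  | 0%N => (f 1%N)%:E * (\sum_(0 <= k <oo) (K 1%N k * f k)%:E)
           - (f 0%N)%:E * (\sum_(1 <= k <oo) (K k 0%N * f k)%:E)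
  | i.+1 => (f j.+1)%:E * (\sum_(0 <= k <oo) (K j.+1 k * f k)%:E)
            - (f j)%:E * (\sum_(0 <= k <oo) (K j k * f k)%:E)
            - (f j)%:E * (\sum_(1 <= k <oo) (K k j * f k)%:E)
            + (f i)%:E * (\sum_(1 <= k <oo) (K k i * f k)%:E)
  end.

(* A time-dependent sequence is f : R -> nat -> R; only times t >= 0 matter. *)

Definition mild_solution (R : realType) (K : nat -> nat -> R) (r T : R)
    (f0 : nat -> R) (f : R -> nat -> R) : Prop :=
  [/\ f 0%R = f0,
      forall t : R, (0 <= t < T)%R -> inYplus r (f t),
      (forall j : nat, {within `[0%R, T[, continuous (fun t => f t j)}) /\
      ereal_sup [set normY r (f t) | t in `[0%R, T[] < +oo,
      forall (j : nat) (t : R), (0 <= t < T)%R ->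
        \int[lebesgue_measure]_(s in `[0%R, t])
          (\sum_(0 <= k <oo) (K j k * f s k)%:E) < +oo
    & forall (j : nat) (t : R), (0 <= t < T)%R ->
        (f t j)%:E = (f0 j)%:E +
          \int[lebesgue_measure]_(s in `[0%R, t]) EDG_rhs K (f s) j].

Definition global_mild_solution (R : realType) (K : nat -> nat -> R) (r : R)
    (f0 : nat -> R) (f : R -> nat -> R) : Prop :=
  forall T : R, (0 < T)%R -> mild_solution K r T f0 f.

(* g is continuously differentiable on [0, +oo[ with derivative dg, the
   derivative at 0 being one-sided. *)
Definition C1_nneg (R : realType) (g dg : R -> R) : Prop :=
  (forall t : R, (0 <= t)%R ->
     (fun s : R => (g s - g t) / (s - t))%R @ within [set s : R | (0 <= s)%R] t^'
       --> dg t) /\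
  {within `[0%R, +oo[, continuous dg}.

(* The finiteness clause makes every series in the equations a convergent one,
   so that no convention for products with +oo in \bar R is involved. *)
Definition C1_solution (R : realType) (K : nat -> nat -> R) (f0 : nat -> R)
    (f : R -> nat -> R) : Prop :=
  [/\ f 0%R = f0,
      forall (j : nat) (t : R), (0 <= t)%R ->
        \sum_(0 <= k <oo) (K j k * f t k)%:E < +oo
    & forall j : nat, exists dfj : R -> R,
        C1_nneg (fun t => f t j) dfj /\
        forall t : R, (0 <= t)%R -> (dfj t)%:E = EDG_rhs K (f t) j].

Local Close Scope ereal_scope.

(* Only the values at j <= N are meaningful. *)
Definition trunc_rhs (R : realType) (K : nat -> nat -> R) (N : nat)
    (g : nat -> R) (j : nat) : R :=
  match j with
  | 0%N => g 1%N * (\sum_(0 <= k < N) K 1%N k * g k)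
           - g 0%N * (\sum_(1 <= k < N.+1) K k 0%N * g k)
  | i.+1 =>
      if (j < N)%N then
        g j.+1 * (\sum_(0 <= k < N) K j.+1 k * g k)
        - g j * (\sum_(0 <= k < N) K j k * g k)
        - g j * (\sum_(1 <= k < N.+1) K k j * g k)
        + g i * (\sum_(1 <= k < N.+1) K k i * g k)
      else
        - (g j * (\sum_(0 <= k < N) K j k * g k))
        + g i * (\sum_(1 <= k < N.+1) K k i * g k)
  end.

Definition trunc_solution (R : realType) (K : nat -> nat -> R) (f0 : nat -> R)
    (N : nat) (g : R -> nat -> R) : Prop :=
  [/\ forall j : nat, (j <= N)%N -> g 0 j = f0 j,
      forall (j : nat) (t : R), (j <= N)%N -> 0 <= t -> 0 <= g t j,
      forall j : nat, (j <= N)%N ->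
        C1_nneg (fun t => g t j) (fun t => trunc_rhs K N (g t) j)
    & forall (j : nat) (t : R), (N < j)%N -> 0 <= t -> g t j = 0].

Definition limit_of_truncations (R : realType) (K : nat -> nat -> R)
    (f0 : nat -> R) (f : R -> nat -> R) : Prop :=
  exists (fN : nat -> R -> nat -> R) (phi : nat -> nat),
    [/\ forall N : nat, (2 <= N)%N -> trunc_solution K f0 N (fN N),
        forall n : nat, (2 <= phi n)%N,
        {homo phi : m n / (m < n)%N}
      & forall (j : nat) (T : R), 0 < T ->
          {uniform `[0, T],
            (fun (n : nat) (t : R) => fN (phi n) t j) @ \oo -->
            (fun t : R => f t j)}].

(* Main.v *)
Require Import Defs.
From HB Require Import structures.
From mathcomp Require Import all_boot all_order all_algebra.
From mathcomp Require Import all_classical all_reals all_analysis.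
From mathcomp Require Import ring lra.
Import Order.TTheory GRing.Theory Num.Theory.
Import numFieldNormedType.Exports.
Set Implicit Arguments.
Unset Strict Implicit.
Unset Printing Implicit Defensive.
Local Open Scope classical_set_scope.
Local Open Scope ring_scope.

(** Everything rests on a bound, uniform in the truncation, for a moment
    slightly stronger than the moment of order r (r = max(mu, nu) in case
    (a), r = 1 in case (b)). By de la Vallee-Poussin there is a weight w,
    increasing to infinity with w_j / (j + 1) decreasing, such that sum_j
    j^r w_j f_j(0) is finite. The convex sequence phi_j = sum_(1 <= i <= j)
    i^(r-1) w_i is comparable to j^r w_j, and since mu + nu <= 3 its second
    difference at l, multiplied by K_(j,l), is at most a multiple of j phi_l
    + l phi_j. In the weak form of the truncated system, first differences
    of phi symmetrise into second ones, so Gronwall's inequality and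
    conservation of the first moment bound sum_j phi_j f^N_j(t) uniformly in
    N. As w is unbounded, the tails of the moments of order at most r are
    uniformly small in N and locally uniformly in time: M_0 and M_1 pass to
    the limit, and the series sum_k K_(j,k) f_k(t) are continuous in t,
    whence the integrated equations can be differentiated. *)

(** * Slowly increasing weights *)

Lemma nondecreasing_seqS (R : realType) (w : nat -> R) :
  (forall j, w j <= w j.+1) -> {homo w : m n / (m <= n)%N >-> m <= n}.
Proof.
move=> wS m n; elim: n => [|n IHn]; first by rewrite leqn0 => /eqP ->.
by rewrite leq_eqVlt ltnS => /predU1P[->//|/IHn /le_trans]; exact.
Qed.

(* With T the tail sums, a_j / sqrt T_j <= 2 (sqrt T_j - sqrt T_(j+1)) telescopes;
   the geometric term keeps every tail positive. *)
Lemma summable_unbounded_weight (R : realType) (a : nat -> R) (B : R) :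
    (forall j, 0 <= a j) -> (forall n, \sum_(0 <= i < n) a i <= B) ->
  exists (v : nat -> R) (B' : R), [/\ forall j, 0 < v j,
    forall j, v j <= v j.+1, forall M, exists j, M <= v j
    & forall n, \sum_(0 <= i < n) a i * v i <= B'].
Proof.
move=> a0 aB.
pose b j := a j + 2^-1 ^+ j.+1.
pose S n := \sum_(0 <= i < n) b i.
have bgt0 j : 0 < b j by rewrite ltr_wpDl// exprn_gt0// invr_gt0.
have SS n : S n.+1 = S n + b n by rewrite /S big_nat_recr.
have SB n : S n <= B + 1.
  rewrite /S big_split/= lerD//.
  suff -> : \sum_(0 <= i < n) 2^-1 ^+ i.+1 = 1 - 2^-1 ^+ n :> R.
    by rewrite gerBl exprn_ge0// invr_ge0.
  elim: n => [|n IHn]; first by rewrite big_nil expr0 subrr.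
  by rewrite big_nat_recr//= IHn exprS; field.
have Snd : nondecreasing_seq S.
  by apply: nondecreasing_seqS => j; rewrite SS lerDl ltW.
have Scv : cvgn S.
  by apply: nondecreasing_is_cvgn => //; exists (B + 1) => _ [n _ <-].
pose L := limn S.
have SL n : S n < L.
  apply: (@lt_le_trans _ _ (S n.+1)); first by rewrite SS ltrDl.
  exact: nondecreasing_cvgn_le.
pose T n := Num.sqrt (L - S n).
have T_gt0 n : 0 < T n by rewrite sqrtr_gt0 subr_gt0.
have TS n : T n.+1 <= T n by rewrite /T ler_wsqrtr// lerB// Snd.
exists (fun n => (T n)^-1), (2 * T 0%N); split.
- by move=> j; rewrite invr_gt0.
- by move=> j; rewrite lef_pV2 ?posrE.
- move=> M; pose M' := Num.max 1 M.
  have M'0 : 0 < M' by rewrite lt_max ltr01.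
  have e0 : 0 < (M' ^+ 2)^-1 by rewrite invr_gt0 exprn_gt0.
  move/cvgrPdist_lt : (Scv) => /(_ _ e0)[N _ /(_ N (leqnn _))/= LS].
  exists N; apply: (@le_trans _ _ M'); first by rewrite le_max lexx orbT.
  rewrite -[leLHS]invrK lef_pV2 ?posrE ?invr_gt0//.
  have -> : M'^-1 = Num.sqrt (M'^-1 ^+ 2).
    by rewrite sqrtr_sqr ger0_norm// invr_ge0 ltW.
  rewrite /T ler_wsqrtr//.
  by rewrite exprVn (le_trans (ler_norm _))// ltW.
- suff H n : \sum_(0 <= i < n) a i * (T i)^-1 <= 2 * (T 0%N - T n).
    by move=> n; rewrite (le_trans (H n))// ler_pM2l// gerBl ltW.
  elim: n => [|n IHn]; first by rewrite big_nil subrr mulr0.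
  rewrite big_nat_recr//= (_ : 2 * _ = 2 * (T 0%N - T n) + 2 * (T n - T n.+1));
    last by ring.
  rewrite lerD// ler_pdivrMr//.
  have ab : a n <= b n by rewrite lerDl exprn_ge0// invr_ge0.
  have TE k : T k ^+ 2 = L - S k by rewrite sqr_sqrtr// subr_ge0 ltW.
  have := TS n; have := T_gt0 n.+1; have := TE n; have := TE n.+1.
  rewrite SS; nra.
Qed.

(** The weight [v] of the preceding lemma may jump, so [w] follows it with its growth capped: each
    step multiplies by at most (j + 2) / (j + 1). Since w <= v, summability persists. *)
Lemma summable_slow_weight (R : realType) (a : nat -> R) (B : R) :
    (forall j, 0 <= a j) -> (forall n, \sum_(0 <= i < n) a i <= B) ->
  exists (w : nat -> R) (B' : R), [/\ forall j, 0 < w j,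
    forall j, w j <= w j.+1, forall j, w j.+1 * j.+1%:R <= w j * j.+2%:R,
    forall M, exists j, M <= w j
    & forall n, \sum_(0 <= i < n) a i * w i <= B'].
Proof.
move=> a0 /(summable_unbounded_weight a0)[v [B' [v0 vS voo vB]]].
pose w := nat_rect (fun _ => R) (v 0%N)
  (fun j wj => Num.min (v j.+1) (wj * (j.+2%:R / j.+1%:R))).
have wE j : w j.+1 = Num.min (v j.+1) (w j * (j.+2%:R / j.+1%:R)) by [].
have wv j : w j <= v j by case: j => [|j]//; rewrite wE ge_min lexx.
have r1 j : 1 <= j.+2%:R / j.+1%:R :> R by rewrite ler_pdivlMr// mul1r ler_nat.
have w0 j : 0 < w j.
  elim: j => [|j IHj]; first exact: v0.
  by rewrite wE lt_min v0/= mulr_gt0// divr_gt0.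
exists w, B'; split => //.
- by move=> j; rewrite wE le_min (le_trans (wv j))//= ler_peMr// ltW.
- move=> j; rewrite -ler_pdivlMr// wE ge_min -mulrA lexx orbT//.
- move=> M; have [I MI] := voo M.
  (* From [I] on, [w] dominates the smaller of the constant [v I] and the linear growth permitted by
     the cap; both eventually reach [M]. *)
  have wI j : (I <= j)%N -> Num.min (v I) (w I * (j.+1%:R / I.+1%:R)) <= w j.
    elim: j => [|j IHj].
      by rewrite leqn0 => /eqP ->; rewrite ge_min lexx.
    rewrite leq_eqVlt ltnS => /predU1P[<-|Ij].
      by rewrite divff// mulr1 ge_min lexx orbT.
    rewrite wE le_min; apply/andP; split.
      by rewrite ge_min (nondecreasing_seqS vS)// ltnW.
    apply: le_trans (ler_wpM2r _ (IHj Ij)); last by rewrite divr_ge0.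
    rewrite minr_pMl; last by rewrite divr_ge0.
    rewrite le_min; apply/andP; split.
      by rewrite ge_min ler_peMr// ltW.
    rewrite ge_min; apply/orP; right.
    have n0 k : k.+1%:R != 0 :> R by rewrite pnatr_eq0.
    rewrite le_eqVlt; apply/orP; left; apply/eqP; field.
    by rewrite !nat1r ?n0.
  (* The linear bound w_I (j + 1) / (I + 1) reaches [M] as soon as j + 1 >= c. *)
  pose c := M * I.+1%:R / w I.
  exists (maxn I (Num.truncn c)).
  apply: le_trans (wI _ (leq_maxl _ _)); rewrite le_min MI/= mulrA.
  rewrite ler_pdivlMr// -ler_pdivrMl// mulrC.
  apply: (le_trans (ltW (truncnS_gt c))).
  by rewrite ler_nat ltnS leq_maxr.
- move=> n; apply: le_trans (vB n).
  by rewrite ler_sum// => i _; rewrite ler_wpM2l.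
Qed.

(** * Power weights and their convex primitives *)

(** If a <= 1 the two factors compare separately. Otherwise the surplus exponent a - 1 moves from x
    to the larger base y, where the total a - 1 + b is at most s. *)
Lemma powRM_le_exchange (R : realType) (x y a b s : R) :
  1 <= x -> x <= y -> b <= s -> a + b <= s + 1 -> x `^ a * y `^ b <= x * y `^ s.
Proof.
move=> x1 xy bs abs; have y1 := le_trans x1 xy.
have x0 : 0 < x := lt_le_trans ltr01 x1; have y0 := lt_le_trans x0 xy.
have [a1|/ltW a1] := leP a 1.
  by rewrite ler_pM ?powR_ge0 ?ler1_powR ?ler_powR.
rewrite -mulr_powRB1 ?(ltW x0) ?(lt_le_trans ltr01 a1)// -mulrA ler_pM2l//.
 apply: (@le_trans _ _ (y `^ (a - 1) * y `^ b)).
  rewrite ler_wpM2r ?powR_ge0// ge0_ler_powR ?subr_ge0 ?nnegrE//; exact: ltW.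
by rewrite -powRD ?(gt_eqF y0) ?implybT// ler_powR//; lra.
Qed.

(** The factor l^(r-2) is the size of a second difference. It is merged with l^n, and the previous
    lemma is applied with the smaller of j and l as base x; m + n <= 3 is exactly the condition on
    the total exponent in both orders. *)
Lemma powR_kernel_exchange (R : realType) (w : nat -> R) (m n r : R) (j l : nat) :
    (forall j, 0 < w j) -> (forall j, w j <= w j.+1) ->
    n <= 2 -> m <= r -> r <= 2 -> m + n <= 3 -> (0 < j)%N -> (0 < l)%N ->
  j%:R `^ m * l%:R `^ n * l%:R `^ (r - 2) * w l <=
    j%:R * l%:R `^ r * w l + l%:R * j%:R `^ r * w j.
Proof.
move=> w0 wS n2 mr r2 mn j0 l0.
have j1 : 1 <= j%:R :> R by rewrite ler1n.
have l1 : 1 <= l%:R :> R by rewrite ler1n.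
rewrite -(mulrA _ _ (l%:R `^ (r - 2))) -powRD; last first.
  by rewrite pnatr_eq0 -lt0n l0 implybT.
have [jl|/ltnW lj] := leqP j l.
  apply: (@le_trans _ _ (j%:R * l%:R `^ r * w l)); last first.
    by rewrite lerDl !mulr_ge0 ?powR_ge0 ?(ltW (w0 _)).
  by rewrite (ler_pM2r (w0 l)) powRM_le_exchange ?ler_nat//; lra.
apply: (@le_trans _ _ (l%:R * j%:R `^ r * w j)); last first.
  by rewrite lerDr !mulr_ge0 ?powR_ge0 ?(ltW (w0 _)).
rewrite ler_pM ?mulr_ge0 ?powR_ge0 ?(ltW (w0 _)) ?(nondecreasing_seqS wS)//.
by rewrite mulrC powRM_le_exchange ?ler_nat//; lra.
Qed.

Definition power_weight (R : realType) (r : R) (w : nat -> R) (j : nat) : R :=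
  j%:R `^ (r - 1) * w j.

(** The sum starts at [p 1]: the value at 0 is then 0, like that of j^r w_j for r >= 1, and the
    first difference at j is [p j.+1]. *)
Definition primitive (R : realType) (p : nat -> R) (j : nat) : R :=
  \sum_(0 <= i < j) p i.+1.

Lemma primitiveS (R : realType) (p : nat -> R) j :
  primitive p j.+1 = primitive p j + p j.+1.
Proof. by rewrite /primitive big_nat_recr. Qed.

Lemma primitive_ge0 (R : realType) (p : nat -> R) j :
  (forall j, 0 <= p j.+1) -> 0 <= primitive p j.
Proof. by move=> p0; rewrite /primitive sumr_ge0. Qed.

(** The growth condition is an equality for p_j = j (j + 1), whose sum is j (j + 1) (j + 2) / 3;
    this is where the constant 3 comes from. *)
Lemma primitive_ge (R : realType) (p : nat -> R) j :
    (forall j, 0 <= p j.+1) ->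
    (forall j, p j.+2 * j.+1%:R <= p j.+1 * j.+3%:R) ->
  j%:R * p j <= 3 * primitive p j.
Proof.
move=> p0 pS; elim: j => [|[|i] IHi].
- by rewrite mul0r /primitive big_nil mulr0.
- by rewrite /primitive big_nat1; have := p0 0%N; lra.
- rewrite primitiveS; have := pS i; have := p0 i; have := p0 i.+1; move: IHi.
  rewrite -!natr1; have := ler0n R i; move: i%:R (p i.+2) (p i.+1) => x b a.
  move: (primitive _ _) => P x0 aP b0 a0 ba.
  (* With the factor x + 3, the induction hypothesis and the growth bound chain to (x + 1)^2 b <= 3
     P (x + 3), and (x - 1) (x + 3) <= (x + 1)^2. *)
  suff : (x - 1) * (x + 3) * b <= 3 * P * (x + 3) by nra.
  by nra.
Qed.

Section PowerWeight.
Variables (R : realType) (r : R) (w : nat -> R).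
Hypotheses (w_gt0 : forall j, 0 < w j) (w_nd : forall j, w j <= w j.+1).
Hypothesis w_slow : forall j, w j.+1 * j.+1%:R <= w j * j.+2%:R.
Hypotheses (r1 : 1 <= r) (r2 : r <= 2).

Let p := power_weight r w.

Lemma power_weight_ge0 j : 0 <= p j.
Proof. by rewrite mulr_ge0 ?powR_ge0 ?ltW. Qed.

Lemma power_weight_nd j : p j.+1 <= p j.+2.
Proof.
rewrite ler_pM ?powR_ge0 ?(ltW (w_gt0 _))//.
by rewrite ge0_ler_powR ?subr_ge0 ?nnegrE// ler_nat.
Qed.

(** Two ratios multiply: that of the powers is at most (j + 2) / (j + 1) because r - 1 <= 1, that of
    [w] at most (j + 3) / (j + 2). The product telescopes. *)
Lemma power_weight_slow j : p j.+2 * j.+1%:R <= p j.+1 * j.+3%:R.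
Proof.
have r11 : r - 1 <= 1 by move: r2; lra.
have jE : j.+2%:R = j.+1%:R * (j.+2%:R / j.+1%:R) :> R.
  by rewrite mulrC divfK// pnatr_eq0.
have q1 : 1 <= j.+2%:R / j.+1%:R :> R by rewrite ler_pdivlMr// mul1r ler_nat.
have : j.+2%:R `^ (r - 1) * j.+1%:R <= j.+1%:R `^ (r - 1) * j.+2%:R.
  rewrite {1}jE powRM// ?(le_trans _ q1)// -mulrA ler_wpM2l ?powR_ge0//.
  by rewrite -ler_pdivlMr// ler1_powR.
have := w_slow j.+1; have := w_gt0 j.+1; have := w_gt0 j.+2.
have := powR_gt0 (r - 1) (ltr0Sn R j).
have := powR_gt0 (r - 1) (ltr0Sn R j.+1).
rewrite /p /power_weight; move: (j.+2%:R `^ _) (j.+1%:R `^ _) (w _) (w _).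
move=> B A a b B0 A0 b0 a0.
move: (ltr0Sn R j) (ltr0Sn R j.+1) (ltr0Sn R j.+2).
move: j.+1%:R j.+2%:R j.+3%:R => x y z x0 y0 z0 h1 h2.
rewrite -(ler_pM2r y0) (_ : _ * y = (B * x) * (b * y)); last by ring.
rewrite [leRHS](_ : _ = (A * y) * (a * z)); last by ring.
by rewrite ler_pM// mulr_ge0 ?ltW.
Qed.

Lemma power_weight_primitive_ge j :
  (0 < j)%N -> j%:R `^ r * w j <= 3 * primitive p j.
Proof.
move=> j0; apply: le_trans (primitive_ge _ _ _); first last.
- exact: power_weight_slow.
- by move=> ?; exact: power_weight_ge0.
- by rewrite /p /power_weight mulrA mulr_powRB1//; move: r1; lra.
Qed.

(** As [p] increases, its sum up to j is at most j p_j = j^r w_j. With the preceding lemma, the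
    convex primitive and j^r w_j are comparable. *)
Lemma power_weight_primitive_le j :
  (0 < j)%N -> primitive p j <= j%:R `^ r * w j.
Proof.
elim: j => // -[_ _|j IHj _].
  by rewrite /primitive big_nat1 /p /power_weight !powR1.
rewrite primitiveS.
apply: (@le_trans _ _ (j.+1%:R * p j.+1 + p j.+2)).
  rewrite lerD2r (le_trans (IHj _))// /p /power_weight mulrA mulr_powRB1//; move: r1; lra.
apply: (@le_trans _ _ (j.+2%:R * p j.+2)).
  have := power_weight_nd j; have := ler0n R j.
  rewrite -!natr1; nra.
rewrite /p /power_weight mulrA mulr_powRB1//; move: r1; lra.
Qed.

(** The left side is the second difference of the primitive. The growth bound makes it at most 2 p_j
    / j, and p_j / j = j^(r-2) w_j. *)
Lemma power_weight_diff j : (0 < j)%N ->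
  p j.+1 - p j <= 2 * j%:R `^ (r - 2) * w j.
Proof.
case: j => // j _; have := power_weight_slow j.
have -> : j.+3%:R = j.+1%:R + 2 :> R by rewrite -addn2 natrD.
rewrite mulrDr -lerBlDl -mulrBl -ler_pdivlMr//.
rewrite (_ : r - 2 = (r - 1) - 1); last by ring.
rewrite (@powRB _ _ (r - 1)) ?pnatr_eq0 ?implybT// powRr1//.
by move/le_trans; apply; rewrite /p /power_weight le_eqVlt;
   apply/orP; left; apply/eqP; ring.
Qed.

(** The constant 12 is 2 * 2 * 3: the second difference, the two summands of the kernel bound, and
    the passage from j^r w_j to the primitive. *)
Lemma kernel_power_weight_diff (K : nat -> nat -> R) (Cq mu nu : R) j l :
    0 < Cq -> kernel_bound Cq mu nu K ->
    mu <= r -> nu <= r -> mu + nu <= 3 -> (0 < j)%N -> (0 < l)%N ->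
  K j l * (p l.+1 - p l) <=
    12 * Cq * (j%:R * primitive p l + l%:R * primitive p j).
Proof.
move=> Cq0 HK mur nur munu j0 l0.
have [K0 [_ KC]] := HK j l.
have d0 : 0 <= p l.+1 - p l by case: l l0 {K0 KC} => // l _; rewrite subr_ge0 power_weight_nd.
apply: (le_trans (ler_wpM2r d0 KC)).
set u := (X in Cq * X).
have u0 : 0 <= u by rewrite addr_ge0// mulr_ge0 ?powR_ge0.
have Cu0 : 0 <= Cq * u by rewrite mulr_ge0// ltW.
apply: (le_trans (ler_wpM2l Cu0 (power_weight_diff l0))).
have h1 : u * (l%:R `^ (r - 2) * w l) <=
    2 * (j%:R * l%:R `^ r * w l + l%:R * j%:R `^ r * w j).
  rewrite /u mulrDl mulr_natl mulr2n !mulrA lerD// powR_kernel_exchange//; move: r2; lra.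
have h2 : j%:R * (l%:R `^ r * w l) <= j%:R * (3 * primitive p l).
  by rewrite ler_wpM2l// power_weight_primitive_ge.
have h3 : l%:R * (j%:R `^ r * w j) <= l%:R * (3 * primitive p j).
  by rewrite ler_wpM2l// power_weight_primitive_ge.
rewrite !mulrA in h2 h3; rewrite -(mulrA 2).
move: (ltW Cq0) h1 h2 h3; clearbody u.
move: (j%:R * _ * w l) (l%:R * _ * w j) (l%:R `^ _ * w l) => a b x C0 h1 h2 h3.
have : u * x <= 6 * (j%:R * primitive p l + l%:R * primitive p j) by lra.
nra.
Qed.

End PowerWeight.

(** * Truncated systems *)

Lemma summation_by_parts (R : realType) (phi J : nat -> R) (n : nat) :
  - (phi 0%N * J 0%N) + \sum_(0 <= j < n) phi j.+1 * (J j - J j.+1) =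
  \sum_(0 <= i < n) (phi i.+1 - phi i) * J i - phi n * J n.
Proof.
elim: n => [|n IHn]; first by rewrite !big_nil addr0 sub0r.
by rewrite !big_nat_recr//= addrA IHn; ring.
Qed.

(* [K i.+1 k * g i.+1 * g k] is the rate of the exchange (i+1, k) -> (i, k+1). *)
Lemma trunc_rhs_weak (R : realType) (K : nat -> nat -> R) (N : nat)
    (g phi : nat -> R) : (0 < N)%N ->
  \sum_(0 <= j < N.+1) phi j * trunc_rhs K N g j =
  \sum_(0 <= i < N) \sum_(0 <= k < N) K i.+1 k * g i.+1 * g k *
     ((phi k.+1 - phi k) - (phi i.+1 - phi i)).
Proof.
move=> N0.
pose A j := g j * \sum_(0 <= k < N) K j k * g k.
pose B j := g j * \sum_(1 <= k < N.+1) K k j * g k.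
(* [J i] is the net flux from size i to size i + 1: growth of clusters of size i minus shrinking of
   those of size i + 1. Cutting it off at [N] gives the equations for 1 <= j <= N the common form
   J_(j-1) - J_j. *)
pose J i := if (i < N)%N then B i - A i.+1 else 0.
have JN : J N = 0 by rewrite /J ltnn.
transitivity (\sum_(0 <= i < N) (phi i.+1 - phi i) * J i).
  have := summation_by_parts phi J N; rewrite JN mulr0 subr0 => <-.
  rewrite big_nat_recl//; congr (_ + _).
    by rewrite /J N0 /trunc_rhs /A /B; ring.
  rewrite !big_nat; apply: eq_bigr => j jN; congr (_ * _).
  move/andP: jN => [_ jN]; rewrite /= /J jN.
  by case: ifPn => _; rewrite /A /B; ring.
transitivity (\sum_(0 <= i < N) (phi i.+1 - phi i) * B i -
    \sum_(0 <= i < N) (phi i.+1 - phi i) * A i.+1).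
  rewrite -sumrB !big_nat; apply: eq_bigr => i /andP[_ iN].
  by rewrite /J iN mulrBr.
transitivity (\sum_(0 <= i < N) \sum_(0 <= k < N)
      K i.+1 k * g i.+1 * g k * (phi k.+1 - phi k) -
    \sum_(0 <= i < N) \sum_(0 <= k < N)
      K i.+1 k * g i.+1 * g k * (phi i.+1 - phi i)); last first.
  rewrite -sumrB; apply: eq_bigr => i _; rewrite -sumrB.
  by apply: eq_bigr => k _; ring.
congr (_ - _).
  rewrite exchange_big_nat/=; apply: eq_bigr => i _.
  rewrite /B big_add1/= mulrA big_distrr/=; apply: eq_bigr => k _; ring.
apply: eq_bigr => i _; rewrite /A mulrA big_distrr/=.
by apply: eq_bigr => k _; ring.
Qed.

Section TruncMoments.
Variables (R : realType) (K : nat -> nat -> R) (N : nat).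
Hypotheses (N_gt0 : (0 < N)%N) (K_sym : forall j k, K j k = K k j).

Lemma trunc_rhs_mass (g : nat -> R) :
  \sum_(0 <= j < N.+1) trunc_rhs K N g j = 0.
Proof.
rewrite (eq_bigr (fun j => 1 * trunc_rhs K N g j)); last by move=> j _; rewrite mul1r.
rewrite (trunc_rhs_weak K g (fun=> 1))// big1// => i _; rewrite big1// => k _.
by rewrite !subrr mulr0.
Qed.

(** As for the total mass, the test sequence has constant first differences, so every exchange
    contributes zero. *)
Lemma trunc_rhs_first_moment (g : nat -> R) :
  \sum_(0 <= j < N.+1) j%:R * trunc_rhs K N g j = 0.
Proof.
rewrite (trunc_rhs_weak K g (fun j => j%:R))// big1// => i _; rewrite big1// => k _.
by rewrite -!natr1; ring.
Qed.

(* Symmetrising over the exchanges between nonempty clusters turns the first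
   differences of phi into second differences; convexity of phi discards the
   exchanges with empty clusters and those from clusters of maximal size. *)
Lemma trunc_rhs_convex_moment (g phi : nat -> R) (D : R) :
    (forall j k, 0 <= K j k) -> (forall j, (j <= N)%N -> 0 <= g j) ->
    (forall j, 0 <= phi j) -> 0 <= D ->
    (forall j, phi j.+1 - phi j <= phi j.+2 - phi j.+1) ->
    (forall j l, (0 < j)%N -> K j l.+1 *
       ((phi l.+2 - phi l.+1) - (phi l.+1 - phi l)) <=
       D * (j%:R * phi l.+1 + l.+1%:R * phi j)) ->
  \sum_(0 <= j < N.+1) phi j * trunc_rhs K N g j <=
  2 * D * (\sum_(0 <= j < N.+1) j%:R * g j) * \sum_(0 <= j < N.+1) phi j * g j.
Proof.
move=> K0 g0 phi0 D0 cvx KD; rewrite trunc_rhs_weak//.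
case: N N_gt0 g0 => // M _ g0.
pose c i := phi i.+1 - phi i.
have c_nd : {homo c : m n / (m <= n)%N >-> m <= n}.
  exact: nondecreasing_seqS.
have G0 i k : (i < M.+1)%N -> (k < M.+1)%N -> 0 <= K i.+1 k * g i.+1 * g k.
  by move=> iM kM; rewrite !mulr_ge0// g0// ltnW.
pose S i k := K i.+1 k.+1 * g i.+1 * g k.+1.
apply: (@le_trans _ _ (\sum_(0 <= i < M) \sum_(0 <= k < M) S i k * (c k.+1 - c i))).
  rewrite big_nat_recr//= -[leRHS]addr0 lerD//.
    rewrite !big_nat ler_sum// => i /andP[_ iM].
    rewrite big_nat_recl//= -[leRHS]add0r lerD//.
    by rewrite mulr_ge0_le0 ?G0 ?subr_le0 ?c_nd// ltnW.
  rewrite big_nat sumr_le0// => k /andP[_ kM].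
  by rewrite mulr_ge0_le0 ?G0 ?subr_le0 ?c_nd.
(* [S] is symmetric in i and k, so relabelling turns [c i] into [c k] and leaves the second
   difference of [phi] at k + 1. *)
have -> : \sum_(0 <= i < M) \sum_(0 <= k < M) S i k * (c k.+1 - c i) =
    \sum_(0 <= i < M) \sum_(0 <= k < M) S i k * (c k.+1 - c k).
  have SE u : \sum_(0 <= i < M) \sum_(0 <= k < M) S i k * (c k.+1 - u i k) =
      \sum_(0 <= i < M) \sum_(0 <= k < M) S i k * c k.+1 -
      \sum_(0 <= i < M) \sum_(0 <= k < M) S i k * u i k.
    rewrite -sumrB; apply: eq_bigr => i _; rewrite -sumrB.
    by apply: eq_bigr => k _; rewrite mulrBr.
  rewrite (SE (fun i _ => c i)) (SE (fun _ k => c k)); congr (_ - _).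
  rewrite exchange_big_nat/=; apply: eq_bigr => i _; apply: eq_bigr => k _.
  by rewrite /S K_sym; ring.
pose U := \sum_(0 <= i < M) i.+1%:R * g i.+1.
pose V := \sum_(0 <= i < M) phi i.+1 * g i.+1.
apply: (@le_trans _ _ (2 * D * U * V)).
  apply: (@le_trans _ _ (\sum_(0 <= i < M) \sum_(0 <= k < M)
     (D * (i.+1%:R * g i.+1) * (phi k.+1 * g k.+1) +
      D * (phi i.+1 * g i.+1) * (k.+1%:R * g k.+1)))).
    rewrite !big_nat ler_sum// => i /andP[_ iM].
    rewrite !big_nat ler_sum// => k /andP[_ kM].
    have gi : 0 <= g i.+1 by rewrite g0// ltnS ltnW.
    have gk : 0 <= g k.+1 by rewrite g0// ltnS ltnW.
    have := ler_wpM2r (mulr_ge0 gi gk) (KD i.+1 k isT).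
    by rewrite /S /c; lra.
  rewrite le_eqVlt; apply/orP; left; apply/eqP.
  transitivity (D * U * V + D * V * U); last by ring.
  have distr (a b : nat -> R) (n : nat) (y : R) :
      D * (\sum_(0 <= i < n) a i * b i) * y = \sum_(0 <= i < n) D * (a i * b i) * y.
    by rewrite mulr_sumr mulr_suml.
  rewrite {1}/U {2}/V 2!distr -big_split/=.
  apply: eq_bigr => i _; rewrite big_split/=; congr (_ + _);
    by rewrite -mulr_sumr.
have UV (psi : nat -> R) : (forall j, 0 <= psi j) ->
    0 <= \sum_(0 <= i < M) psi i.+1 * g i.+1 <= \sum_(0 <= j < M.+2) psi j * g j.
  move=> psi0; apply/andP; split.
    by rewrite big_nat sumr_ge0// => i /andP[_ iM]; rewrite mulr_ge0// g0// ltnS ltnW.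
  rewrite big_nat_recl//= big_nat_recr//= addrCA lerDl addr_ge0//.
    by rewrite mulr_ge0// g0.
  by rewrite mulr_ge0// g0.
have /andP[U0 UU] := UV (fun j => j%:R) (@ler0n _).
have /andP[V0 VV] := UV phi phi0.
by rewrite -!(mulrA (2 * D)) ler_wpM2l ?ler_pM// mulr_ge0.
Qed.

End TruncMoments.

(** * Differentiable functions on the closed half-line and Gronwall's inequality *)

Section C1Nneg.
Variable R : realType.
Implicit Types g dg : R -> R.

Lemma C1_nneg_quotient g dg (t e : R) : C1_nneg g dg -> 0 <= t -> 0 < e ->
  exists2 d, 0 < d & forall s, 0 <= s -> s != t -> `|s - t| < d ->
    `|dg t - (g s - g t) / (s - t)| < e.
Proof.
move=> [dgP _] t0 e0; move/cvgrPdist_lt : (dgP t t0) => /(_ e e0).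
move=> /nbhs_ballP[d /= d0 dP]; exists d => // s s0 st sd.
by apply: dP => //; rewrite /ball/= distrC.
Qed.

Lemma C1_nneg_is_derive g dg (t : R) :
  C1_nneg g dg -> 0 < t -> is_derive t (1 : R) g (dg t).
Proof.
move=> gC1 t0.
suff H : h^-1 *: ((g \o shift t) (h *: 1) - g t) @[h --> 0^'] --> dg t.
  by apply: DeriveDef; [apply/cvg_ex; exists (dg t)|exact/cvg_lim].
apply/cvgrPdist_lt => e e0.
have [d d0 dP] := C1_nneg_quotient gC1 (ltW t0) e0.
apply/nbhs_ballP; exists (Num.min d t) => /=; first by rewrite lt_min d0.
move=> h; rewrite /ball/= sub0r normrN lt_min => /andP[hd ht] h0.
have -> : h *: (1 : R) = h by rewrite /GRing.scale/= mulr1.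
have := dP (h + t); rewrite addrK -subr_eq0 addrK /GRing.scale/= (mulrC h^-1).
apply => //; move: ht; rewrite ltr_norml => /andP[ht _]; lra.
Qed.

(** Near 0 the difference quotient is bounded by |dg 0| + 1. This gives the endpoint continuity on
    which the monotonicity argument for Gronwall's inequality relies. *)
Lemma C1_nneg_right g dg : C1_nneg g dg -> g s @[s --> 0^'+] --> g 0.
Proof.
move=> gC1; apply/cvgrPdist_lt => e e0.
have [d d0 dP] := C1_nneg_quotient gC1 (lexx 0) ltr01.
pose M := `|dg 0| + 1.
have M0 : 0 < M by rewrite ltr_wpDl.
apply/nbhs_ballP; exists (Num.min d (e / M)) => /=; first by rewrite lt_min d0 divr_gt0.
move=> s; rewrite /ball/= sub0r normrN lt_min => /andP[sd se] s0.
have := dP s (ltW s0) (lt0r_neq0 s0); rewrite subr0 => /(_ sd) H.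
have qM : `|(g s - g 0) / s| <= M.
  rewrite -[X in `|X|](subrK (dg 0)) (le_trans (ler_normD _ _))//.
  by rewrite addrC lerD2l distrC ltW.
rewrite distrC -[X in `|X|](divfK (lt0r_neq0 s0)) normrM (gtr0_norm s0).
apply: (le_lt_trans (ler_wpM2r (ltW s0) qM)).
by move: se; rewrite (gtr0_norm s0) ltr_pdivlMr// mulrC.
Qed.

(** The integrating factor exp(-C s) makes the product [h] non-increasing: its derivative is at most
    0 for s > 0, and [h] is right-continuous at 0. *)
Lemma C1_nneg_gronwall g dg (C : R) : C1_nneg g dg ->
    (forall t, 0 <= t -> dg t <= C * g t) ->
  forall t, 0 <= t -> g t <= g 0 * expR (C * t).
Proof.
move=> gC1 dgC t t0.
pose h s := g s * expR (- C * s).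
suff : h t <= h 0.
  rewrite /h mulr0 expR0 mulr1 => H.
  rewrite -(ler_pM2r (expR_gt0 (- C * t))) -mulrA -expRD.
  by rewrite mulNr subrr expR0 mulr1 -mulNr.
have dh (s : R) : 0 < s -> is_derive s (1 : R) h
    (g s * (expR (- C * s) * - C) + expR (- C * s) * dg s).
  move=> s0; have gd := C1_nneg_is_derive gC1 s0.
  have ed : is_derive s (1 : R) (fun s => expR (- C * s)) (expR (- C * s) * - C).
    have ld := is_deriveZ (- C) (is_derive_id s (1 : R)).
    have := is_derive1_comp (is_derive_expR (- C * s)) ld.
    by rewrite /GRing.scale/= mulr1.
  exact: is_deriveM.
apply: (@ler0_derive1_nincry _ h 0) => //.
- by move=> s; rewrite in_itv/= andbT => /dh[].
- move=> s; rewrite in_itv/= andbT => s0; rewrite derive1E; have [_ ->] := dh s s0.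
  have := dgC s (ltW s0); have := expR_gt0 (- C * s); nra.
- apply/continuous_within_itvcyP; split=> [s|].
    rewrite in_itv/= andbT => /dh[dhs _].
    exact/differentiable_continuous/derivable1_diffP.
  apply: cvgM; first exact: C1_nneg_right gC1.
  apply: cvg_at_right_filter; apply: continuous_comp; first exact: mulrl_continuous.
  exact: continuous_expR.
Qed.

Lemma C1_nneg_lin (n : nat) (c : nat -> R) (g dg : nat -> R -> R) :
    (forall j, (j < n)%N -> C1_nneg (g j) (dg j)) ->
  C1_nneg (fun t => \sum_(0 <= j < n) c j * g j t)
          (fun t => \sum_(0 <= j < n) c j * dg j t).
Proof.
elim: n => [|n IHn] gC1.
  split=> [t t0|].
    under eq_fun do rewrite !big_nil subrr mul0r.
    rewrite big_nil; exact: cvg_cst.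
  have -> : (fun t => \sum_(0 <= j < 0) c j * dg j t) = cst 0.
    by apply/funext => t; rewrite big_nil.
  by apply: continuous_subspaceT => t; exact: cst_continuous.
have [Q1 Q2] := IHn (fun j jn => gC1 j (ltnW jn)); have [q1 q2] := gC1 n (ltnSn n).
split=> [t t0|].
  under eq_fun do rewrite !big_nat_recr//= opprD addrACA -mulrBr mulrDl -mulrA.
  rewrite big_nat_recr//=; apply: cvgD; first exact: Q1.
  by apply: cvgM; [exact: cvg_cst|exact: q1].
have -> : (fun t => \sum_(0 <= j < n.+1) c j * dg j t) =
    (fun t => \sum_(0 <= j < n) c j * dg j t + c n * dg n t).
  by apply/funext => t; rewrite big_nat_recr.
apply: within_continuousD => // t; apply: continuousM; last exact: q2.
exact: cvg_cst.
Qed.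

Lemma C1_nneg_cst g dg : C1_nneg g dg -> (forall t, 0 <= t -> dg t = 0) ->
  forall t, 0 <= t -> g t = g 0.
Proof.
move=> gC1 dg0 t t0; apply/eqP; rewrite eq_le; apply/andP; split.
  have := C1_nneg_gronwall (C := 0) gC1 _ t0.
  by rewrite mul0r expR0 mulr1; apply => s s0; rewrite mul0r dg0.
(* For the lower bound, Gronwall's inequality with C = 0 is applied to -g, written as a linear
   combination with one term. *)
have := @C1_nneg_lin 1 (fun=> -1) (fun=> g) (fun=> dg) (fun _ _ => gC1).
move=> /C1_nneg_gronwall => /(_ 0 _ t t0).
rewrite mul0r expR0 mulr1 !big_nat1 !mulN1r lerN2; apply => s s0.
by rewrite mul0r big_nat1 dg0// mulr0.
Qed.
End C1Nneg.

(** * Conservation laws and moment bounds uniform in the truncation *)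

Lemma sum_le_support (R : realType) (a : nat -> R) (N n : nat) :
    (forall j, (j < N)%N -> 0 <= a j) -> (forall j, (N <= j)%N -> a j = 0) ->
  \sum_(0 <= j < n) a j <= \sum_(0 <= j < N) a j.
Proof.
move=> a0 aN; have [nN|Nn] := leqP n N.
  rewrite (big_cat_nat (leq0n n) nN)/= lerDl big_nat sumr_ge0// => i /andP[_ iN].
  exact: a0.
rewrite (big_cat_nat (leq0n N) (ltnW Nn))/= gerDl big_nat big1//.
by move=> i /andP[Ni _]; exact: aN.
Qed.

Section TruncSolution.
Variables (R : realType) (K : nat -> nat -> R) (f0 : nat -> R) (N : nat).
Variable g : R -> nat -> R.
Hypotheses (N_gt0 : (0 < N)%N) (gsol : trunc_solution K f0 N g).

Lemma trunc_solution_ge0 t j : 0 <= t -> 0 <= g t j.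
Proof.
move=> t0; case: gsol => _ g0 _ gN.
by have [jN|Nj] := leqP j N; [exact: g0|rewrite gN].
Qed.

Lemma trunc_solution_C1 (c : nat -> R) :
  C1_nneg (fun t => \sum_(0 <= j < N.+1) c j * g t j)
          (fun t => \sum_(0 <= j < N.+1) c j * trunc_rhs K N (g t) j).
Proof.
case: gsol => _ _ gC1 _.
exact: (@C1_nneg_lin _ _ c (fun j t => g t j) (fun j t => trunc_rhs K N (g t) j)).
Qed.

Lemma trunc_solution_init (c : nat -> R) :
  \sum_(0 <= j < N.+1) c j * g 0 j = \sum_(0 <= j < N.+1) c j * f0 j.
Proof.
by case: gsol => gi _ _ _; rewrite !big_nat; apply: eq_bigr => j /andP[_ jN]; rewrite gi.
Qed.

Hypothesis K_sym : forall j k, K j k = K k j.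

(** The factor 1 keeps the shape [psi j * h n j] in which the passage to the limit treats both
    conserved moments at once. *)
Lemma trunc_solution_mass t : 0 <= t ->
  \sum_(0 <= j < N.+1) 1 * g t j = \sum_(0 <= j < N.+1) 1 * f0 j.
Proof.
move=> t0; rewrite -(trunc_solution_init (fun=> 1)).
apply: (C1_nneg_cst (trunc_solution_C1 (fun=> 1))) => // s s0.
rewrite -[RHS](trunc_rhs_mass K N_gt0 (g s)).
by apply: eq_bigr => j _; rewrite mul1r.
Qed.

Lemma trunc_solution_first_moment t : 0 <= t ->
  \sum_(0 <= j < N.+1) j%:R * g t j = \sum_(0 <= j < N.+1) j%:R * f0 j.
Proof.
move=> t0; rewrite -(trunc_solution_init (fun j => j%:R)).
apply: (C1_nneg_cst (trunc_solution_C1 (fun j => j%:R))) => // s s0.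
exact: trunc_rhs_first_moment.
Qed.

Variables (Cq mu nu r rho B : R) (w : nat -> R).
Hypotheses (Cq_gt0 : 0 < Cq) (HK : kernel_bound Cq mu nu K).
Hypotheses (r1 : 1 <= r) (r2 : r <= 2) (mur : mu <= r) (nur : nu <= r).
Hypothesis munu : mu + nu <= 3.
Hypotheses (w_gt0 : forall j, 0 < w j) (w_nd : forall j, w j <= w j.+1).
Hypothesis w_slow : forall j, w j.+1 * j.+1%:R <= w j * j.+2%:R.
Hypothesis f0_ge0 : forall j, 0 <= f0 j.
Hypothesis f0_rho : forall n, \sum_(0 <= j < n) j%:R * f0 j <= rho.
Hypothesis f0_B : forall n, \sum_(0 <= j < n) j%:R `^ r * f0 j * w j <= B.

(** The convex primitive satisfies a Gronwall inequality whose rate 24 Cq rho is 2 * 12 Cq times a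
    bound for the conserved first moment. The factor 3 comes from comparing j^r w_j with the
    primitive. Nothing on the right depends on [N]. *)
Lemma trunc_solution_weighted_moment n t : 0 <= t ->
  \sum_(0 <= j < n) j%:R `^ r * w j * g t j <= 3 * B * expR (24 * Cq * rho * t).
Proof.
move=> t0.
pose phi := primitive (power_weight r w).
have p0 j : 0 <= power_weight r w j.+1 by exact: power_weight_ge0.
have phi0 j : 0 <= phi j by exact: primitive_ge0.
have r_neq0 : r != 0 by rewrite gt_eqF// (lt_le_trans ltr01).
have wphi j : j%:R `^ r * w j <= 3 * phi j.
  have [->|j0] := posnP j; first by rewrite powR0// mul0r mulr_ge0.
  exact: power_weight_primitive_ge.
have phiw j : phi j <= j%:R `^ r * w j.
  have [->|j0] := posnP j; first by rewrite /phi /primitive big_nil powR0// mul0r.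
  exact: power_weight_primitive_le.
have phiE j : phi j.+1 - phi j = power_weight r w j.+1.
  by rewrite /phi primitiveS addrC addKr.
have rho0 : 0 <= rho by apply: le_trans (f0_rho 0%N); rewrite big_nil.
apply: (@le_trans _ _ (3 * \sum_(0 <= j < N.+1) phi j * g t j)).
  apply: (@le_trans _ _ (\sum_(0 <= j < N.+1) j%:R `^ r * w j * g t j)).
    apply: sum_le_support => [j _|j Nj].
      by rewrite !mulr_ge0 ?powR_ge0 ?trunc_solution_ge0// ltW.
    by case: gsol => _ _ _ -> //; rewrite mulr0.
  rewrite mulr_sumr ler_sum// => j _; rewrite mulrA ler_wpM2r//.
  exact: trunc_solution_ge0.
rewrite -mulrA ler_pM2l//.
have gron := C1_nneg_gronwall (C := 24 * Cq * rho) (trunc_solution_C1 phi).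
apply: le_trans (gron _ _ t0) _ => [s s0|].
  have := @trunc_rhs_convex_moment _ K _ N_gt0 K_sym (g s) phi (12 * Cq).
  rewrite trunc_solution_first_moment//.
  set M1 := \sum_(0 <= j < _) _; set P := \sum_(0 <= j < _) phi j * g s j.
  move=> H; apply: le_trans (H _ _ _ _ _ _) _.
  - by move=> j k; case: (HK j k).
  - by move=> j _; exact: trunc_solution_ge0.
  - exact: phi0.
  - by rewrite mulr_ge0// ltW.
  - by move=> j; rewrite !phiE; exact: power_weight_nd.
  - move=> j l j0; rewrite !phiE.
    exact: (kernel_power_weight_diff w_gt0 w_nd w_slow r1 r2 Cq_gt0 HK).
  - have P0 : 0 <= P by rewrite sumr_ge0// => j _; rewrite mulr_ge0 ?trunc_solution_ge0.
    rewrite ler_wpM2r// (_ : 2 * (12 * Cq) = 24 * Cq); last by ring.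
    by rewrite ler_wpM2l ?mulr_ge0 ?(ltW Cq_gt0) ?f0_rho.
rewrite ler_pM2r ?expR_gt0// trunc_solution_init.
apply: le_trans (f0_B N.+1); rewrite ler_sum// => j _.
by rewrite mulrAC ler_wpM2r.
Qed.

End TruncSolution.

(** * Passage to the limit *)

Lemma nneseries_EFin_leP (R : realType) (a : nat -> R) (m : nat) (B : R) :
    (forall k, 0 <= a k) ->
  (\sum_(m <= k <oo) (a k)%:E <= B%:E)%E <->
  forall n, \sum_(m <= k < n) a k <= B.
Proof.
move=> a0; split=> [sB n|sB].
  rewrite -lee_fin -sumEFin; apply: le_trans sB.
  by apply: nneseries_lim_ge => k _ _; rewrite lee_fin.
apply: lime_le; first by apply: is_cvg_nneseries => k _ _; rewrite lee_fin.
by apply: nearW => n; rewrite sumEFin lee_fin.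
Qed.

Lemma nneseries_EFin_fine (R : realType) (a : nat -> R) (m : nat) :
    (forall k, 0 <= a k) -> (\sum_(m <= k <oo) (a k)%:E < +oo)%E ->
  (\sum_(m <= k <oo) (a k)%:E = (fine (\sum_(m <= k <oo) (a k)%:E))%:E)%E.
Proof.
move=> a0 foo; rewrite fineK// ge0_fin_numE//.
by apply: nneseries_ge0 => k _ _; rewrite lee_fin.
Qed.

Lemma uniform_cvg_at (T : choiceType) (R : realType) (A : set T)
    (h : nat -> T -> R) (l : T -> R) (x : T) :
  A x -> {uniform A, h @ \oo --> l} -> h n x @[n --> \oo] --> l x.
Proof.
move=> Ax hl.
have : {uniform [set x], h @ \oo --> l}.
  by apply: cvg_trans hl _; apply: uniform_subset_nbhs => _ ->.
by rewrite uniform_set1.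
Qed.

(** A Chebyshev estimate: w_j >= w_m on the tail. *)
Lemma weighted_tail_le (R : realType) (b w : nat -> R) (m n : nat) (B : R) :
    (forall j, 0 < w j) -> (forall j, w j <= w j.+1) -> (forall j, 0 <= b j) ->
    (forall n, \sum_(0 <= j < n) w j * b j <= B) ->
  \sum_(m <= j < n) b j <= B / w m.
Proof.
move=> w0 wS b0 bB; rewrite ler_pdivlMr// mulr_suml.
have [nm|mn] := leqP n m.
  by rewrite big_geq//; apply: le_trans (bB 0%N); rewrite big_nil.
apply: le_trans (bB n); rewrite (big_cat_nat (leq0n m) (ltnW mn))/=.
rewrite -[leLHS]add0r lerD//; first by rewrite sumr_ge0// => j _; rewrite mulr_ge0// ltW.
rewrite !big_nat ler_sum// => j /andP[mj _].
by rewrite mulrC ler_wpM2r// (nondecreasing_seqS wS).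
Qed.

Section LimitMoments.
Variables (R : realType) (r B : R) (w : nat -> R) (h : nat -> nat -> R).
Variables (g0 g : nat -> R) (psi : nat -> R) (phi : nat -> nat).
Hypotheses (w_gt0 : forall j, 0 < w j) (w_nd : forall j, w j <= w j.+1).
Hypothesis w_unbounded : forall M, exists j, M <= w j.
Hypothesis phi_inc : {homo phi : m n / (m < n)%N}.
Hypotheses (h_ge0 : forall n j, 0 <= h n j) (g0_ge0 : forall j, 0 <= g0 j).
Hypothesis h_cvg : forall j, h n j @[n --> \oo] --> g j.
Hypotheses (psi_ge0 : forall j, 0 <= psi j).
Hypothesis psi_r : forall j, (0 < j)%N -> psi j <= j%:R `^ r.
Hypothesis h_B : forall n m, \sum_(0 <= j < m) j%:R `^ r * w j * h n j <= B.
Hypothesis h_supp : forall n j, (phi n < j)%N -> h n j = 0.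
Hypothesis h_psi : forall n,
  \sum_(0 <= j < (phi n).+1) psi j * h n j = \sum_(0 <= j < (phi n).+1) psi j * g0 j.

Lemma increasing_ge_id n : (n <= phi n)%N.
Proof. by elim: n => // n IHn; exact: leq_ltn_trans IHn (phi_inc (ltnSn n)). Qed.

Lemma sum_cvg (c : nat -> R) (m : nat) :
  \sum_(0 <= j < m) c j * h n j @[n --> \oo] --> \sum_(0 <= j < m) c j * g j.
Proof.
elim: m => [|m IHm].
  by under eq_fun do rewrite big_nil; rewrite big_nil; exact: cvg_cst.
under eq_fun do rewrite big_nat_recr//=.
rewrite big_nat_recr//=; apply: cvgD => //.
by apply: cvgM; [exact: cvg_cst|exact: h_cvg].
Qed.

Lemma limit_ge0 j : 0 <= g j.
Proof.
rewrite -(cvg_lim _ (@h_cvg j))//; apply: limr_ge; first exact: cvgP (@h_cvg j).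
by apply: nearW => n; exact: h_ge0.
Qed.

Lemma limit_sum_le (c : nat -> R) (m : nat) (C : R) :
    (\forall n \near \oo, \sum_(0 <= j < m) c j * h n j <= C) ->
  \sum_(0 <= j < m) c j * g j <= C.
Proof.
move=> H; have cv := @sum_cvg c m.
by rewrite -(cvg_lim _ cv)//; apply: limr_le => //; exact: cvgP cv.
Qed.

Lemma limit_sum_ge (c : nat -> R) (m : nat) (C : R) :
    (\forall n \near \oo, C <= \sum_(0 <= j < m) c j * h n j) ->
  C <= \sum_(0 <= j < m) c j * g j.
Proof.
move=> H; have cv := @sum_cvg c m.
by rewrite -(cvg_lim _ cv)//; apply: limr_ge => //; exact: cvgP cv.
Qed.

Lemma limit_weighted_moment m : \sum_(0 <= j < m) j%:R `^ r * w j * g j <= B.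
Proof. by apply: limit_sum_le; apply: nearW => n; exact: h_B. Qed.

(** Once phi_k >= n, the conserved sum for the k-th truncation exceeds the left side; split at n,
    its tail is at most B / w_n <= B / w_m. Positivity of m keeps j = 0 out of the tail, where psi_j
    <= j^r may fail. *)
Lemma limit_partial_moment_ge m n : (0 < m)%N -> (m <= n)%N ->
  \sum_(0 <= j < n) psi j * g0 j <= \sum_(0 <= j < n) psi j * g j + B / w m.
Proof.
move=> m0 mn; rewrite -lerBlDr; apply: limit_sum_ge.
near=> k.
have nk : (n <= (phi k).+1)%N.
  rewrite (leq_trans _ (leqW (increasing_ge_id k)))//; near: k.
  exact: nbhs_infty_ge.
rewrite lerBlDr.
apply: (@le_trans _ _ (\sum_(0 <= j < (phi k).+1) psi j * h k j)).
  rewrite h_psi [leRHS](big_cat_nat (leq0n n) nk)/= lerDl sumr_ge0// => j _.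
  exact: mulr_ge0.
rewrite (big_cat_nat (leq0n n) nk)/= lerD2l.
apply: (@le_trans _ _ (\sum_(n <= j < (phi k).+1) j%:R `^ r * h k j)).
  rewrite !big_nat ler_sum// => j /andP[nj _]; rewrite ler_wpM2r// psi_r//.
  by rewrite (leq_trans m0)// (leq_trans mn).
apply: (@le_trans _ _ (B / w n)).
  apply: weighted_tail_le => //; first by move=> j; rewrite mulr_ge0// powR_ge0.
  by move=> p; under eq_bigr do rewrite mulrCA mulrA; exact: h_B.
have B0 : 0 <= B by apply: le_trans (h_B 0 0); rewrite big_nil.
by rewrite ler_wpM2l// lef_pV2 ?posrE// (nondecreasing_seqS w_nd).
Unshelve. all: by end_near. Qed.

(** Time is fixed here: [h] are the truncated solutions, [g] their limit and [g0] the initial data.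
    The upper bound is of Fatou type, by finite partial sums; the lower one rests on the uniform
    tails, which exclude loss of moment to infinity. *)
Lemma limit_moment (L : R) :
    (\sum_(0 <= j <oo) (psi j * g0 j)%:E = L%:E)%E ->
  (\sum_(0 <= j <oo) (psi j * g j)%:E = L%:E)%E.
Proof.
move=> g0L.
have g_ge0 := limit_ge0.
have pg0 j : 0 <= psi j * g0 j by exact: mulr_ge0.
have pg j : 0 <= psi j * g j by exact: mulr_ge0.
have g0Ln n : \sum_(0 <= j < n) psi j * g0 j <= L.
  by move: n; apply/(nneseries_EFin_leP 0 L pg0); rewrite g0L.
have gL : (\sum_(0 <= j <oo) (psi j * g j)%:E <= L%:E)%E.
  apply/nneseries_EFin_leP => // n; apply: limit_sum_le.
  near=> k.
  apply: le_trans (g0Ln (phi k).+1); rewrite -h_psi.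
  apply: sum_le_support => [j _|j jk]; first exact: mulr_ge0.
  by rewrite h_supp ?mulr0.
apply/eqP; rewrite eq_le gL/=.
have gfin := nneseries_EFin_fine pg (le_lt_trans gL (ltry _)).
rewrite gfin -g0L; apply/nneseries_EFin_leP => // n.
have B0 : 0 <= B by apply: le_trans (h_B 0 0); rewrite big_nil.
apply/ler_addgt0Pr => e e0.
(* This choice makes the tail error B / w_(m+1) at most [e]. *)
have [m mw] := w_unbounded ((B + 1) / e).
pose p := maxn n m.+1.
apply: (@le_trans _ _ (\sum_(0 <= j < p) psi j * g0 j)).
  by rewrite [leRHS](big_cat_nat (leq0n n) (leq_maxl n m.+1))/= lerDl sumr_ge0.
apply: le_trans (@limit_partial_moment_ge m.+1 p isT (leq_maxr _ _)) _.
rewrite lerD//; first by move: p; apply/(nneseries_EFin_leP 0 _ pg); rewrite gfin.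
rewrite ler_pdivrMr//.
have := le_trans mw (w_nd m); rewrite ler_pdivrMr//; lra.
Unshelve. all: by end_near. Qed.

End LimitMoments.

(** * Continuous differentiability *)

(* Composing with [Num.max t 0] extends a curve from [0, +oo[ to the whole line,
   so that continuity and the fundamental theorem of calculus apply at 0 too. *)
Lemma continuous_extend_nneg (R : realType) (g : R -> R) :
    (forall T : R, 0 < T -> {within `[0, T[, continuous g}) ->
  continuous (fun t : R => g (Num.max t 0)).
Proof.
move=> gc t; pose T := `|t| + 1.
have T0 : 0 < T by rewrite ltr_wpDl.
have mT (s : R) : s < T -> `[0, T[%classic (Num.max s 0).
  by move=> sT; rewrite /= in_itv/= le_max lexx orbT/= gt_max sT.
have tT : t < T by rewrite (le_lt_trans (ler_norm t))// ltrDl.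
have /subspace_continuousP/(_ _ (mT t tT)) := gc T T0.
move/cvgrPdist_lt => H; apply/cvgrPdist_lt => e e0.
have := H e e0; rewrite near_withinE => {}H.
have mc : Num.max (s : R) 0 @[s --> (t : R)] --> Num.max t 0.
  by apply: continuous_max; [exact: cvg_id|exact: cvg_cst].
have := mc _ H; apply: filterS2 (@lt_nbhsl _ _ _ tT) => s sT; apply.
exact: mT.
Qed.

Section SeriesContinuity.
Variables (R : realType) (r B C : R) (w : nat -> R) (f : R -> nat -> R).
Hypotheses (w_gt0 : forall j, 0 < w j) (w_nd : forall j, w j <= w j.+1).
Hypothesis w_unbounded : forall M, exists j, M <= w j.
Hypotheses (B_ge0 : 0 <= B) (C_ge0 : 0 <= C).
Hypothesis f_ge0 : forall t j, 0 <= t -> 0 <= f t j.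
Hypothesis f_cont : forall j, continuous (fun t : R => f (Num.max t 0) j).
Hypothesis f_B : forall t m, 0 <= t ->
  \sum_(0 <= j < m) j%:R `^ r * w j * f t j <= B * expR (C * t).
Variables (c : nat -> R) (D : R) (i : nat).
Hypotheses (c_ge0 : forall j, 0 <= c j) (D_gt0 : 0 < D).
Hypothesis c_D : forall j, (0 < j)%N -> c j <= D * j%:R `^ r.

(** The weighted moment controls the tail beyond m with an error that tends to 0 as m grows,
    uniformly for t in bounded intervals. *)
Lemma series_partial_le t m n : 0 <= t -> (0 < m)%N -> (i <= m)%N ->
  \sum_(i <= j < n) c j * f t j <=
  \sum_(i <= j < m) c j * f t j + D * (B * expR (C * t)) / w m.
Proof.
move=> t0 m0 im.
have cf0 j : 0 <= c j * f t j by rewrite mulr_ge0// f_ge0.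
have err0 : 0 <= D * (B * expR (C * t)) / w m.
  by rewrite divr_ge0 ?mulr_ge0 ?expR_ge0 ?(ltW D_gt0) ?(ltW (w_gt0 _)).
have [nm|/ltnW mn] := leqP n m.
  apply: ler_wpDr => //.
  have [ni|/ltnW ni] := leqP n i.
    by rewrite big_geq// sumr_ge0.
  by rewrite [leRHS](big_cat_nat ni nm)/= lerDl sumr_ge0.
rewrite (big_cat_nat im mn)/= lerD2l.
apply: (@le_trans _ _ (\sum_(m <= j < n) D * (j%:R `^ r * f t j))).
  rewrite !big_nat ler_sum// => j /andP[mj _]; rewrite mulrA ler_wpM2r ?f_ge0//.
  by rewrite c_D// (leq_trans m0).
rewrite -mulr_sumr -!mulrA ler_pM2l// mulrA.
apply: weighted_tail_le => //; first by move=> j; rewrite mulr_ge0 ?powR_ge0 ?f_ge0.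
by move=> p; under eq_bigr do rewrite mulrCA mulrA; exact: f_B.
Qed.

Lemma series_fin t : 0 <= t -> (\sum_(i <= j <oo) (c j * f t j)%:E < +oo)%E.
Proof.
move=> t0; apply: le_lt_trans (ltry _); apply/nneseries_EFin_leP => [j|n].
  by rewrite mulr_ge0// f_ge0.
exact: (@series_partial_le t i.+1).
Qed.

Let S (t : R) := fine (\sum_(i <= j <oo) (c j * f (Num.max t 0) j)%:E)%E.

(** The partial sums [P m] are continuous and converge to [S] locally uniformly; an e/2 argument on
    times below |t| + 1 concludes. *)
Lemma continuous_series : continuous S.
Proof.
have cf0 t j : 0 <= t -> 0 <= c j * f t j by move=> t0; rewrite mulr_ge0// f_ge0.
have mx0 (t : R) : 0 <= Num.max t 0 by rewrite le_max lexx orbT.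
have SE t : (\sum_(i <= j <oo) (c j * f (Num.max t 0) j)%:E = (S t)%:E)%E.
  by apply: nneseries_EFin_fine; [move=> j; exact: cf0|exact: series_fin].
pose P m (t : R) := \sum_(i <= j < m) c j * f (Num.max t 0) j.
have PS m t : P m t <= S t.
  by move: m; apply/(nneseries_EFin_leP i _ (fun j => @cf0 _ j (mx0 t))); rewrite SE.
have SP m t : (0 < m)%N -> (i <= m)%N ->
    S t <= P m t + D * (B * expR (C * Num.max t 0)) / w m.
  move=> m0 im; rewrite -lee_fin -SE.
  by apply/nneseries_EFin_leP => [j|n]; [exact: cf0|exact: series_partial_le].
have Pc m : continuous (P m).
  elim: m => [|m IHm].
    have -> : P 0%N = cst 0 by apply/funext => t; rewrite /P big_geq.
    exact: cst_continuous.
  have [im|mi] := leqP i m; last first.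
    have -> : P m.+1 = cst 0 by apply/funext => t; rewrite /P big_geq.
    exact: cst_continuous.
  have -> : P m.+1 = (fun t => P m t + c m * f (Num.max t 0) m).
    by apply/funext => t; rewrite /P big_nat_recr.
  move=> t; apply: cvgD; first exact: IHm.
  by apply: cvgM; [exact: cvg_cst|exact: f_cont].
move=> t; apply/cvgrPdist_lt => e e0.
pose T := `|t| + 1.
have T0 : 0 <= T by rewrite addr_ge0.
pose M := D * (B * expR (C * T)).
have M0 : 0 <= M by rewrite !mulr_ge0 ?expR_ge0// ltW.
have [m mM] := w_unbounded ((M + 1) / (e / 2)).
pose n := maxn m.+1 i.
have wn : M / w n < e / 2.
  rewrite ltr_pdivrMr// mulrC -ltr_pdivrMr ?divr_gt0//.
  apply: (@lt_le_trans _ _ ((M + 1) / (e / 2))).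
    by rewrite ltr_pM2r ?invr_gt0 ?divr_gt0// ltrDl.
  apply: (le_trans mM); apply: (nondecreasing_seqS w_nd).
  by rewrite (leq_trans (leqnSn m))// leq_maxl.
have SPT s : s <= T -> P n s <= S s < P n s + e / 2.
  move=> sT; rewrite PS/=; apply: le_lt_trans (SP n s _ _) _.
  - by rewrite leq_max.
  - by rewrite leq_max leqnn orbT.
  rewrite ltrD2l; apply: le_lt_trans wn.
  rewrite ler_wpM2r ?invr_ge0 ?(ltW (w_gt0 _))//.
  by rewrite ler_wpM2l ?(ltW D_gt0)// ler_wpM2l// ler_expR ler_wpM2l// ge_max sT.
have tT : t < T by rewrite (le_lt_trans (ler_norm t))// ltrDl.
have := Pc n t; move/cvgrPdist_lt => /(_ (e / 2)); rewrite divr_gt0// => /(_ isT).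
apply: filterS2 (@lt_nbhsl _ _ _ tT) => s sT.
have /andP[? ?] := SPT s (ltW sT); have /andP[? ?] := SPT t (ltW tT).
rewrite !ltr_norml => /andP[? ?]; apply/andP; split; lra.
Qed.

End SeriesContinuity.

Lemma integral_eq_C1_nneg (R : realType) (g h : R -> R) (g0 : R) :
    continuous h ->
    (forall t, 0 <= t -> (g t)%:E =
      (g0%:E + \int[lebesgue_measure]_(s in `[0%R, t]) (h s)%:E)%E) ->
  C1_nneg g h.
Proof.
move=> hc gE; split; last exact: continuous_subspaceT.
pose mu := @lebesgue_measure R.
have hi (a b : R) : mu.-integrable `[a, b] (EFin \o h).
  apply: continuous_compact_integrable; first exact: segment_compact.
  exact: continuous_subspaceT.
(* Integrating from -1 makes 0 an interior point, so the fundamental theorem of calculus also yields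
   the one-sided derivative at 0. *)
pose F (x : R) : R := \int[mu]_(s in `[-1, x]) h s.
have Fd (x : R) : -1 < x -> derivable F x 1 /\ derive1 F x = h x.
  move=> x1; apply: (@continuous_FTC1_closed _ h (-1) x (x + 1)) => //; last exact: hc.
  by rewrite ltrDl.
have gF (t : R) : 0 <= t -> g t = g0 + (F t - F 0).
  move=> t0; apply: EFin_inj; rewrite gE// EFinD; congr (_ + _)%E.
  rewrite /F Rintegral_itvB//=; last first.
    by rewrite bnd_simp lerN10.
  rewrite Rintegral_itv_obnd_cbnd//; last first.
    apply: (@integrableS _ _ _ mu `[0, t]) => //.
    exact: subset_itv_oc_cc.
  by rewrite /Rintegral fineK// integrable_fin_num.
move=> t t0.
have [dF dFE] := Fd t (lt_le_trans (ltrN10 _) t0).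
have {}dF : s^-1 *: ((F \o shift t) (s *: 1) - F t) @[s --> 0^'] --> h t.
  by rewrite -dFE derive1E; exact: dF.
apply/cvgrPdist_lt => e e0; move/cvgrPdist_lt : dF => /(_ e e0).
move=> /nbhs_ballP[d /= d0 dP].
apply/nbhs_ballP; exists d => //= s; rewrite /ball/= => sd st s0.
have := dP (s - t); rewrite /ball/= sub0r normrN distrC => /(_ sd).
rewrite subr_eq0 => /(_ st); rewrite /GRing.scale/= mulr1 subrK mulrC.
by rewrite !gF// opprD addrACA subrr add0r opprB addrA subrK.
Qed.

(** The summand 1 keeps the constant positive when j = 0, where both powers may vanish. *)
Lemma kernel_le_power (R : realType) (K : nat -> nat -> R) (Cq mu nu r : R) j k :
    0 < Cq -> kernel_bound Cq mu nu K -> mu <= r -> nu <= r -> (0 < k)%N ->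
  K j k <= (Cq * (j%:R `^ mu + j%:R `^ nu) + 1) * k%:R `^ r.
Proof.
move=> Cq0 HK mur nur k0; have [_ [_ KC]] := HK j k.
have k1 : 1 <= k%:R :> R by rewrite ler1n.
apply: le_trans KC _; rewrite mulrDl mul1r ler_wpDr ?powR_ge0//.
rewrite -mulrA ler_pM2l// mulrDl.
by rewrite lerD// ler_wpM2l ?powR_ge0// ler_powR.
Qed.

(** Finiteness of the series turns the extended-real right-hand side into a real polynomial
    expression in continuous functions: the components, the row series [A] and the column series
    [B]. *)
Lemma EDG_rhs_continuous (R : realType) (K : nat -> nat -> R)
    (f : R -> nat -> R) (j : nat) :
    (forall j k, 0 <= K j k) -> (forall t j, 0 <= t -> 0 <= f t j) ->
    (forall j, continuous (fun t : R => f (Num.max t 0) j)) ->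
    (forall (i : nat) (c : nat -> R), (exists j, c = K j \/ c = K ^~ j) ->
      (forall t : R, 0 <= t -> (\sum_(i <= k <oo) (c k * f t k)%:E < +oo)%E) /\
      continuous (fun t : R => fine (\sum_(i <= k <oo) (c k * f (Num.max t 0) k)%:E)%E)) ->
  exists2 h : R -> R, continuous h &
    forall t, 0 <= t -> EDG_rhs K (f t) j = (h t)%:E.
Proof.
move=> K0 f0 fc Kf.
pose fm j (t : R) := f (Num.max t 0) j.
pose A j (t : R) := fine (\sum_(0 <= k <oo) (K j k * f (Num.max t 0) k)%:E)%E.
pose B j (t : R) := fine (\sum_(1 <= k <oo) (K k j * f (Num.max t 0) k)%:E)%E.
have Ac j' : continuous (A j') by apply: (Kf 0%N (K j') _).2; exists j'; left.
have Bc j' : continuous (B j') by apply: (Kf 1%N (K ^~ j') _).2; exists j'; right.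
have AE i t : 0 <= t -> (\sum_(0 <= k <oo) (K i k * f t k)%:E)%E = (A i t)%:E.
  move=> t0; rewrite /A max_l//; apply: nneseries_EFin_fine => [k|].
    by rewrite mulr_ge0// f0.
  by apply: (Kf 0%N (K i) _).1 => //; exists i; left.
have BE i t : 0 <= t -> (\sum_(1 <= k <oo) (K k i * f t k)%:E)%E = (B i t)%:E.
  move=> t0; rewrite /B max_l//; apply: nneseries_EFin_fine => [k|].
    by rewrite mulr_ge0// f0.
  by apply: (Kf 1%N (K ^~ i) _).1 => //; exists i; right.
have fA i l : continuous (fun t => fm i t * A l t).
  by move=> t; apply: cvgM; [exact: fc|exact: Ac].
have fB i l : continuous (fun t => fm i t * B l t).
  by move=> t; apply: cvgM; [exact: fc|exact: Bc].
case: j => [|i].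
  exists (fun t => fm 1%N t * A 1%N t - fm 0%N t * B 0%N t).
    by move=> t; apply: cvgB; [exact: fA|exact: fB].
  by move=> t t0; rewrite /= AE// BE// /fm max_l.
exists (fun t => fm i.+2 t * A i.+2 t - fm i.+1 t * A i.+1 t
  - fm i.+1 t * B i.+1 t + fm i t * B i t).
  move=> t; apply: cvgD; last exact: fB.
  by apply: cvgB; [apply: cvgB; exact: fA|exact: fB].
by move=> t t0; rewrite /= !AE// !BE// /fm max_l.
Qed.

(** * Regularity and conservation for the constructed solution *)

Theorem corollary2p4 (R : realType) (K : nat -> nat -> R) (Cq mu nu : R)
    (Cq_gt0 : 0 < Cq)
    (mu02 : 0 <= mu <= 2) (nu02 : 0 <= nu <= 2) (munu : mu + nu <= 3)
    (HK : kernel_bound Cq mu nu K)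
    (f0 : nat -> R) (rho : R)
    (f0Y1 : inYplus 1 f0) (f0M1 : moment 1 f0 = rho%:E)
    (r : R)
    (Hcase : (1 < Num.max mu nu /\ inYplus (Num.max mu nu) f0 /\
              r = Num.max mu nu) \/
             (Num.max mu nu <= 1 /\ r = 1))
    (f : R -> nat -> R)
    (f_mild : global_mild_solution K r f0 f)
    (f_lim : limit_of_truncations K f0 f)
    (f_Y : forall t : R, 0 <= t -> inYplus r (f t)) :
  C1_solution K f0 f /\
  (forall t : R, 0 <= t ->
     moment 0 (f t) = moment 0 f0 /\ moment 1 (f t) = rho%:E).
Proof.
(* Cases (a) and (b) enter the rest of the proof only through these common properties of [r]. *)
have [r1 [r2 [mur [nur f0Yr]]]] :
    1 <= r /\ r <= 2 /\ mu <= r /\ nu <= r /\ inYplus r f0.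
  have [/andP[_ mu2] /andP[_ nu2]] := (mu02, nu02).
  case: Hcase => [[l1 [f0Y ->]]|[+ ->]].
    by rewrite (ltW l1) ge_max mu2 nu2 !le_max !lexx orbT.
  by rewrite ge_max => /andP[mu1 nu1]; rewrite ler1n.
have K0 j k : 0 <= K j k by case: (HK j k).
have Ksym j k : K j k = K k j by case: (HK j k) => _ [].
have [_ f0_ge0] := f0Y1.
have jf0 j : 0 <= j%:R * f0 j by rewrite mulr_ge0.
have f0M1' : (\sum_(0 <= j <oo) (j%:R * f0 j)%:E = rho%:E)%E.
  by rewrite -f0M1 /moment; apply: eq_eseriesr => j _; rewrite powRr1.
have f0_rho n : \sum_(0 <= j < n) j%:R * f0 j <= rho.
  by move: n; apply/(nneseries_EFin_leP 0 rho jf0); rewrite f0M1'.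
have rho0 : 0 <= rho by apply: le_trans (f0_rho 0%N); rewrite big_nil.
pose a j := j%:R `^ r * f0 j.
have a0 j : 0 <= a j by rewrite mulr_ge0// powR_ge0.
have [M aM] : exists M, forall n, \sum_(0 <= j < n) a j <= M.
  have fin : (\sum_(0 <= j <oo) (a j)%:E < +oo)%E.
    have [+ _] := f0Yr; rewrite /inY /normY; congr (_ < _)%E.
    by apply: eq_eseriesr => j _; rewrite ger0_norm.
  pose M := fine (\sum_(0 <= j <oo) (a j)%:E)%E.
  by exists M; apply/(nneseries_EFin_leP 0 M a0); rewrite -nneseries_EFin_fine.
(* The weight depends only on the initial data, hence serves all truncations and all times. *)
have [w [B [w0 w_nd w_slow w_oo aB]]] := summable_slow_weight a0 aM.
have B0 : 0 <= B by apply: le_trans (aB 0%N); rewrite big_nil.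
case: f_lim => fN [phi [fNsol phi2 phi_inc fN_cvg]].
have fNcvg t j : 0 <= t -> fN (phi n) t j @[n --> \oo] --> f t j.
  move=> t0; have T0 : 0 < t + 1 by rewrite ltr_wpDl.
  have tT : `[0, t + 1]%classic t by rewrite /= in_itv/= t0 lerDl/=.
  exact: (uniform_cvg_at tT (fN_cvg j _ T0)).
have phi0 n : (0 < phi n)%N by exact: ltnW (phi2 n).
have sol n := fNsol (phi n) (phi2 n).
have h_ge0 t n j : 0 <= t -> 0 <= fN (phi n) t j.
  by move=> t0; exact: (trunc_solution_ge0 (sol n)).
have f_ge0 t j : 0 <= t -> 0 <= f t j.
  by move=> t0; have [] := f_Y t t0.
have h_B t n m : 0 <= t -> \sum_(0 <= j < m) j%:R `^ r * w j * fN (phi n) t j <=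
    3 * B * expR (24 * Cq * rho * t).
  by move=> t0; exact: (trunc_solution_weighted_moment (phi0 n) (sol n) Ksym Cq_gt0 HK).
have h_supp t n j : 0 <= t -> (phi n < j)%N -> fN (phi n) t j = 0.
  by move=> t0 jn; have [_ _ _ ->] := sol n.
have f_B t m : 0 <= t -> \sum_(0 <= j < m) j%:R `^ r * w j * f t j <=
    3 * B * expR (24 * Cq * rho * t).
  move=> t0; apply: (limit_weighted_moment (h := fun n j => fN (phi n) t j)).
    by move=> j; exact: fNcvg.
  by move=> n p; exact: h_B.
have f_cont j : continuous (fun t : R => f (Num.max t 0) j).
  by apply: (@continuous_extend_nneg _ (f ^~ j)) => T T0; have [_ _ []] := f_mild T T0.
have KD i j : (0 < j)%N -> K i j <= (Cq * (i%:R `^ mu + i%:R `^ nu) + 1) * j%:R `^ r.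
  exact: kernel_le_power.
have D0 i : 0 < Cq * (i%:R `^ mu + i%:R `^ nu) + 1.
  by rewrite ltr_wpDl// mulr_ge0 ?addr_ge0 ?powR_ge0// ltW.
have B'0 : 0 <= 3 * B by rewrite mulr_ge0.
have C0 : 0 <= 24 * Cq * rho by rewrite !mulr_ge0// ltW.
have Kf i (c : nat -> R) : (exists j, c = K j \/ c = K ^~ j) ->
    (forall t : R, 0 <= t -> (\sum_(i <= k <oo) (c k * f t k)%:E < +oo)%E) /\
    continuous (fun t : R => fine (\sum_(i <= k <oo) (c k * f (Num.max t 0) k)%:E)%E).
  move=> [j cj].
  have {cj} -> : c = K j.
    by case: cj => -> //; apply/funext => k.
  split=> [t t0|].
    exact: (series_fin w0 w_nd B'0 f_ge0 f_B i (K0 j) (D0 j) (KD j)).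
  exact: (continuous_series w0 w_nd w_oo B'0 C0 f_ge0 f_cont f_B (K0 j) (D0 j) (KD j)).
split.
  split.
  - by have [] := f_mild 1 ltr01.
  - by move=> j t t0; apply: (Kf 0%N (K j) _).1 => //; exists j; left.
  - move=> j; have [h hc hE] := EDG_rhs_continuous j K0 f_ge0 f_cont Kf.
    exists h; split=> [|t t0]; last by rewrite hE.
    apply: (integral_eq_C1_nneg (g0 := f0 j) hc) => t t0.
    have T0 : 0 < t + 1 by rewrite ltr_wpDl.
    have [_ _ _ _ ->] := f_mild _ T0; last by rewrite t0 ltrDl/=.
    congr (_ + _)%E; apply: eq_integral => s.
    by rewrite inE/= in_itv/= => /andP[s0 _]; rewrite hE.
move=> t t0.
(* Used for psi_j = j and psi_j = 1, both at most j^r for j >= 1 because r >= 1. *)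
have lim psi := @limit_moment R r _ w (fun n j => fN (phi n) t j) f0 (f t) psi phi
  w0 w_nd w_oo phi_inc (fun n j => h_ge0 t n j t0) f0_ge0 (fun j => fNcvg t j t0).
split; last first.
  rewrite /moment -f0M1'; under eq_eseriesr do rewrite powRr1//.
  rewrite f0M1'; apply: lim f0M1' => //.
  - by move=> j j0; rewrite le1r_powR// ler1n.
  - by move=> n m; exact: h_B.
  - by move=> n j; exact: h_supp.
  - by move=> n; exact: (trunc_solution_first_moment (phi0 n) (sol n)).
have mE g : moment 0 g = (\sum_(0 <= j <oo) (1 * g j)%:E)%E.
  by rewrite /moment; apply: eq_eseriesr => j _; rewrite powRr0.
have f1 j : 0 <= 1 * f0 j by rewrite mul1r.
(* M_0 of the initial data is finite, since f_j <= j f_j for j >= 1 bounds it by f_0 + rho. *)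
have L : (\sum_(0 <= j <oo) (1 * f0 j)%:E < +oo)%E.
  apply: le_lt_trans (ltry (f0 0%N + rho)); apply/nneseries_EFin_leP => // -[|n].
    by rewrite big_nil addr_ge0.
  rewrite big_nat_recl// mul1r lerD2l (le_trans _ (f0_rho n.+1))//.
  rewrite [leRHS]big_nat_recl//= mul0r add0r ler_sum// => j _.
  by rewrite ler_wpM2r// ler1n.
rewrite !mE (nneseries_EFin_fine f1 L).
apply: lim (nneseries_EFin_fine f1 L) => //.
- by move=> j j0; rewrite (le_trans _ (le1r_powR _ r1)) ?ler1n.
- by move=> n m; exact: h_B.
- by move=> n j; exact: h_supp.
- by move=> n; exact: (trunc_solution_mass (phi0 n) (sol n)).
Qed.
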